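(* Let $2\le t\le n-1$, and put $T=2^t-1$, $T'=2^{t-1}-1$, $M=2^{n-t}-1$, $M'=2^{n-t+1}-1$. The number $nr_=(n,t)$ of isomorphism classes of Steiner triple systems on $2^n-1$ points with $2$-rank exactly $2^n-n-1+t$ satisfies $$nr_=(n,t)\ge \frac{N_1(T)\cdot(N_2(T+1)\cdot T!)^M\cdot N_3(T+1)^{M(M-1)/6}}{T!\cdot((T+1)!)^M\cdot|PGL(n-t,2)|}-\frac{N_1(T')\cdot(N_2(T'+1)\cdot (T')!)^{M'}\cdot N_3(T'+1)^{M'(M'-1)/6}}{((T'+1)!)^{M'-n+t-2}}.$$
   Context: The $2$-rank of a Steiner triple system is the rank over $\mathrm{GF}(2)$ of its block-by-point incidence matrix. $N_1(v)$ is the number of distinct Steiner triple systems on a fixed labeled $v$-set (with $N_1(1)=1$, the empty system). $N_2(2k)$ is the number of distinct $1$-factorizations of the complete graph on $2k$ fixed vertices. $N_3(g)$ is the number of distinct transversal designs $TD[3;g]$ on three fixed pairwise disjoint groups of size $g$, i.e. sets of $3$-subsets each meeting every group in exactly one point such that any two points from different groups lie in exactly one of these $3$-subsets. $PGL(m,2)=GL(m,2)$, of order $\prod_{i=0}^{m-1}(2^m-2^i)$. *)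

(* Defs.v *)
From HB Require Import structures.
From mathcomp Require Import all_boot all_order all_fingroup all_algebra.

Set Implicit Arguments.
Unset Strict Implicit.
Unset Printing Implicit Defensive.

Import Order.TTheory GRing.Theory Num.Theory.

Local Open Scope nat_scope.

Section SteinerTripleSystems.
Variable T : finType.
Implicit Types B : {set {set T}}.

Definition is_STS B : bool :=
  [forall b in B, #|b| == 3] &&
  [forall x : T, forall y : T, (x != y) ==>
     (#|[set b in B | (x \in b) && (y \in b)]| == 1)].

Definition incidence_mx B : 'M['F_2]_(#|B|, #|T|) :=
  \matrix_(i, j) ((enum_val j \in (enum_val i : {set T}))%:R)%R.

Definition two_rank B : nat := \rank (incidence_mx B).

Definition STS_iso : rel {set {set T}} := fun B B' =>
  [exists s : {perm T}, B' == [set [set s x | x in b] | b : {set T} in B]].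

End SteinerTripleSystems.

Definition num_STS (v : nat) : nat := #|[set B : {set {set 'I_v}} | is_STS B]|.

(* A design on any v-set is isomorphic to one on 'I_v, so the isomorphism
   classes are counted by partitioning the designs on 'I_v. *)
Definition num_STS_classes (v r : nat) : nat :=
  #|equivalence_partition (@STS_iso 'I_v)
      [set B : {set {set 'I_v}} | is_STS B && (two_rank B == r)]|.

Section OneFactorizations.
Variable T : finType.

Definition complete_edges : {set {set T}} := [set e : {set T} | #|e| == 2].

Definition is_one_factor (f : {set {set T}}) : bool :=
  (f \subset complete_edges) && partition f [set: T].

Definition is_one_factorization (F : {set {set {set T}}}) : bool :=
  [forall f in F, is_one_factor f] && partition F complete_edges.

End OneFactorizations.

Definition num_one_factorizations (m : nat) : nat :=
  #|[set F : {set {set {set 'I_m}}} | is_one_factorization F]|.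

(* The three groups are the fibres of the first projection 'I_3 * 'I_g -> 'I_3. *)
Definition TD_group (g : nat) (i : 'I_3) : {set 'I_3 * 'I_g} :=
  [set x | x.1 == i].

Definition is_TD3 (g : nat) (D : {set {set 'I_3 * 'I_g}}) : bool :=
  [forall b in D, (#|b| == 3) &&
     [forall i : 'I_3, #|b :&: TD_group g i| == 1]] &&
  [forall x : 'I_3 * 'I_g, forall y : 'I_3 * 'I_g, (x.1 != y.1) ==>
     (#|[set b in D | (x \in b) && (y \in b)]| == 1)].

Definition num_TD3 (g : nat) : nat :=
  #|[set D : {set {set 'I_3 * 'I_g}} | is_TD3 D]|.

(* Main.v *)
(** Let m = n - t and let lam : V -> F_2^m have a zero fibre of size T and all
other fibres of size T + 1. A Steiner triple system on V whose blocks all have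
label sum 0 splits, according to the label sets {0}, {0, a} and the lines of
PG(m-1, 2), into an STS on the zero fibre, labelled 1-factorizations of the
other fibres, and transversal designs, all chosen independently; this gives the
first numerator. The coordinates of lam then lie in the dual of the binary
code of the system, which has dimension m unless some further word f is dual.
In that case counting third points shows that (lam, f) is again such a labelling
with fibres T' and T' + 1, so the systems of smaller rank number at most the
number of ways to halve the fibres of lam times the second numerator. Finally
two systems whose dual code is spanned by lam are isomorphic only through
permutations s with lam o s = lam A, A in GL(m, 2), and there are at most
|GL(m, 2)| T! ((T+1)!)^M of these. *)

Require Import Defs.
From mathcomp Require Import all_boot all_order all_fingroup all_algebra zify.

Set Implicit Arguments.
Unset Strict Implicit.
Unset Printing Implicit Defensive.

Import Order.TTheory GRing.Theory Num.Theory.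

(** * Label sets of blocks and the product decomposition *)

Definition blocks_through (V : finType) (B : {set {set V}}) (x y : V) :=
  [set b in B | (x \in b) && (y \in b)].

Lemma card3_pair (V : finType) (b : {set V}) (x y : V) :
  #|b| = 3 -> x \in b -> y \in b -> x != y ->
  exists2 z, b = [set x; y; z] & (z != x) && (z != y).
Proof.
move=> b3 xb yb xy.
have : #|b :\ x :\ y| = 1.
  have e1 := cardsD1 x b; have e2 := cardsD1 y (b :\ x).
  by move: e1 e2; rewrite b3 xb !inE yb (eq_sym y) xy /= !add1n => -[<-] [<-].
case/eqP/cards1P=> z bE; exists z.
  apply/setP=> w; move: (in_set1 w z); rewrite -bE !inE.
  case: (eqVneq w x) => [->|_]; first by rewrite xb.
  by case: (eqVneq w y) => [->|_] //=; rewrite yb.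
by have := set11 z; rewrite -bE !inE => /and3P[-> ->].
Qed.

Section TypeDecomposition.
Variables (V : finType) (L : finZmodType) (lam : V -> L).
Hypothesis char2 : forall a : L, (a + a = 0)%R.
Implicit Types (B C : {set {set V}}) (b : {set V}) (j : {set L}) (x y z : V).

Definition lam_block b := (#|b| == 3) && (\sum_(x in b) lam x == 0)%R.

Definition compatible_STS B := is_STS B && [forall b in B, lam_block b].

Definition pair_type x y : {set L} := [set lam x; lam y; (lam x + lam y)%R].

(* In a compatible system every pair {x, y} determines the label set
   pair_type x y of its block, so the blocks with label set j must cover
   exactly the pairs of type j, independently for each j. *)
Definition type_design j C :=
  [forall b in C, lam_block b && (lam @: b == j)] &&
  [forall x, forall y, (x != y) ==> (pair_type x y == j) ==>
     (#|blocks_through C x y| == 1)].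

Lemma oppr_self (a : L) : (- a = a)%R.
Proof. by apply/eqP; rewrite eq_sym -subr_eq0 opprK char2. Qed.

Lemma lam_block_pair b x y : lam_block b -> x \in b -> y \in b -> x != y ->
  exists z, [/\ b = [set x; y; z], z != x, z != y & lam z = (lam x + lam y)%R].
Proof.
case/andP=> /eqP b3 /eqP sb xb yb xy.
have [z bE /andP[zx zy]] := card3_pair b3 xb yb xy.
exists z; split=> //; move: sb; rewrite bE setUC /= big_setU1 ?inE ?negb_or ?zx //=.
rewrite big_setU1 ?inE //= big_set1 => /eqP.
by rewrite addr_eq0 oppr_self => /eqP.
Qed.

Lemma lam_block_type b x y : lam_block b -> x \in b -> y \in b -> x != y ->
  lam @: b = pair_type x y.
Proof.
move=> lb xb yb xy; have [z [-> _ _ lz]] := lam_block_pair lb xb yb xy.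
by rewrite !imsetU !imset_set1 lz.
Qed.

(** All blocks through [x] and [y] have label set [pair_type lam x y], so the condition on this pair
    only sees one class of blocks. *)
Lemma compatible_STS_types B : [forall b in B, lam_block b] ->
  is_STS B = [forall j, type_design j [set b in B | lam @: b == j]].
Proof.
move=> lB; have lamB b : b \in B -> lam_block b by move/forall_inP: lB; apply.
have through x y : x != y ->
    blocks_through [set b in B | lam @: b == pair_type x y] x y
    = blocks_through B x y.
  move=> xy; apply/setP=> b; rewrite !inE.
  case bB: (b \in B) => //=; apply/andb_idl => /andP[xb yb].
  by rewrite (lam_block_type (lamB _ bB) xb yb xy).
apply/idP/forallP.
  case/andP=> B3 /forallP B1 j; apply/andP; split.
    by apply/forall_inP=> b; rewrite inE => /andP[bB ->]; rewrite lamB.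
  apply/forallP=> x; apply/forallP=> y; apply/implyP=> xy.
  apply/implyP=> /eqP <-; rewrite through //.
  by move/forallP/(_ y): (B1 x); rewrite xy.
move=> dB; apply/andP; split.
  by apply/forall_inP=> b /lamB /andP[].
apply/forallP=> x; apply/forallP=> y; apply/implyP=> xy.
case/andP: (dB (pair_type x y)) => _ /forallP/(_ x)/forallP/(_ y).
by rewrite xy eqxx through.
Qed.

(** Sorting blocks by label set is injective. Conversely any choice of one design per type has a
    union that sorts back into the chosen designs, since different types share no block. *)
Lemma card_compatible_STS :
  #|[set B | compatible_STS B]| = \prod_(j : {set L}) #|[set C | type_design j C]|.
Proof.
transitivity #|family (fun j C => type_design j C)|; last first.
  rewrite card_family foldrE big_image /=; apply: eq_bigr => j _.
  by rewrite cardsE.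
pose F B : {ffun {set L} -> {set {set V}}} := [ffun j => [set b in B | lam @: b == j]].
rewrite -(@card_in_imset _ _ F); last first.
  move=> B B' _ _ /ffunP FBB; apply/setP=> b.
  by have := FBB (lam @: b); rewrite !ffunE => /setP/(_ b); rewrite !inE eqxx !andbT.
apply: eq_card => f; apply/imsetP/familyP.
  case=> B; rewrite inE => /andP[sB lB] -> j; rewrite ffunE unfold_in.
  by move: sB; rewrite compatible_STS_types // => /forallP/(_ j).
move=> df; have inf j b : b \in f j -> lam_block b /\ lam @: b = j.
  move=> bf; have := df j; rewrite unfold_in => /andP[/forall_inP/(_ b bf)].
  by case/andP=> -> /eqP.
pose B := \bigcup_j f j.
have fB j : [set b in B | lam @: b == j] = f j.
  apply/setP=> b; rewrite inE; apply/andP/idP.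
    by case=> /bigcupP[i _ bi] /eqP; have [_ ->] := inf _ _ bi; move=> <-.
  by move=> bj; have [_ ->] := inf _ _ bj; split=> //; apply/bigcupP; exists j.
have lB : [forall b in B, lam_block b].
  by apply/forall_inP=> b /bigcupP[j _ /inf[]].
exists B; last by apply/ffunP=> j; rewrite ffunE fB.
rewrite inE /compatible_STS lB andbT compatible_STS_types //.
by apply/forallP=> j; rewrite fB; have := df j; rewrite unfold_in.
Qed.

End TypeDecomposition.

(** * Transport of block sets to standard index sets *)

Lemma card_transport (X Y : finType) (f : X -> Y) (P : pred {set Y}) :
  injective f -> (forall C, P C -> C \subset codom f) ->
  #|[set C | P C]| = #|[set D : {set X} | P (f @: D)]|.
Proof.
move=> injf Pf; rewrite -(card_imset [set D : {set X} | P (f @: D)] (imset_inj injf)).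
apply: eq_card => C; rewrite inE; apply/idP/imsetP => [PC | [D]]; last first.
  by rewrite inE => PD ->.
suff CE : f @: (f @^-1: C) = C by exists (f @^-1: C); rewrite ?inE CE.
apply/setP=> y; apply/imsetP/idP => [[x]|yC]; first by rewrite inE => ? ->.
by have /codomP[x yE] := subsetP (Pf _ PC) _ yC; exists x; rewrite // inE -yE.
Qed.

Lemma enum_set_bij (V : finType) (A : {set V}) (k : nat) : #|A| = k ->
  exists2 h : 'I_k -> V, injective h & A = [set h i | i in 'I_k].
Proof.
move=> Ak; exists (fun i => enum_val (cast_ord (esym Ak) i)).
  by move=> i i' /enum_val_inj /cast_ord_inj.
apply/setP=> x; apply/idP/imsetP => [xA | [i _ ->]]; last exact: enum_valP.
exists (cast_ord Ak (enum_rank_in xA x)) => //.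
by rewrite cast_ord_comp cast_ord_id enum_rankK_in.
Qed.

(** This turns the cover and disjointness clauses into a count of the same shape as the conditions
    on pairs in designs. *)
Lemma partition_unique (T : finType) (P : {set {set T}}) (D : {set T}) :
  (forall A, A \in P -> (A \subset D) && (A != set0)) ->
  partition P D = [forall x in D, #|[set A in P | x \in A]| == 1].
Proof.
move=> PD; apply/idP/forall_inP.
  case/and3P=> /eqP cP tP _ x; rewrite -cP => xc.
  apply/cards1P; exists (pblock P x); apply/setP=> A; rewrite !inE.
  apply/andP/eqP => [[AP xA]| ->]; first by rewrite (def_pblock tP AP xA).
  by rewrite pblock_mem // mem_pblock.
move=> P1; apply/and3P; split.
- apply/eqP/setP=> x; apply/bigcupP/idP => [[A AP xA]|xD].
    by have /andP[/subsetP/(_ _ xA)] := PD _ AP.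
  have /cards1P[A /setP/(_ A)] := P1 _ xD; rewrite !inE eqxx => /andP[AP xA].
  by exists A.
- apply/trivIsetP=> A A' AP A'P; apply: contraNT => /pred0Pn[x /andP[/= xA xA']].
  have /andP[/subsetP/(_ _ xA) xD _] := PD _ AP.
  have /cards1P[A0 /setP E] := P1 _ xD.
  have := E A; have := E A'; rewrite !inE AP A'P xA xA' => /esym/eqP-> /esym/eqP->.
  by [].
- by apply/negP=> /PD /andP[_]; rewrite eqxx.
Qed.

Section BlockImages.
Variables (X V : finType) (h : X -> V).
Hypothesis injh : injective h.
Implicit Types (D : {set {set X}}).

Definition image_blocks D : {set {set V}} := [set h @: (b : {set X}) | b in D].

Lemma blocks_through_image D x y :
  #|blocks_through (image_blocks D) (h x) (h y)| = #|blocks_through D x y|.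
Proof.
rewrite -(card_imset (blocks_through D x y) (imset_inj injh)).
apply: eq_card => b; rewrite inE; apply/andP/imsetP => [[/imsetP[c cD ->]]|[c]].
  by rewrite !mem_imset // => cxy; exists c; rewrite // inE cD.
by rewrite inE => /and3P[cD cx cy] ->; rewrite !imset_f.
Qed.

Lemma card_image_blocks (P : pred {set {set V}}) :
  (forall C b, P C -> b \in C -> b \subset codom h) ->
  #|[set C | P C]| = #|[set D | P (image_blocks D)]|.
Proof.
move=> Ph; apply: (card_transport (imset_inj injh)) => C PC.
apply/subsetP=> b bC; apply/codomP; exists (h @^-1: b).
apply/setP=> y; apply/idP/imsetP => [yb | [x]]; last by rewrite inE => ? ->.
by have /codomP[x yE] := subsetP (Ph _ _ PC bC) _ yb; exists x; rewrite // inE -yE.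
Qed.

End BlockImages.

(** * Type {0}: triple systems on the zero fibre *)

Section TypeCounts.
Variables (V : finType) (L : finZmodType) (lam : V -> L).
Hypothesis char2 : forall a : L, (a + a = 0)%R.

Definition fibre (a : L) : {set V} := [set x | lam x == a].

(** Blocks of this type lie inside the zero fibre, where the label sum vanishes automatically, and
    the pairs of this type are exactly the pairs of that fibre. *)
Lemma card_type_zero k : #|fibre 0%R| = k ->
  #|[set C | type_design lam [set 0%R] C]| = num_STS k.
Proof.
case/enum_set_bij=> h injh hE.
have lamh i : lam (h i) = 0%R.
  have : h i \in fibre 0%R by rewrite hE imset_f.
  by rewrite inE => /eqP.
have hP x : lam x = 0%R -> exists i, x = h i.
  move=> lx; have : x \in fibre 0%R by rewrite inE lx.
  by rewrite hE => /imsetP[i _ ->]; exists i.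
rewrite (card_image_blocks injh); last first.
  move=> C b /andP[/forall_inP/(_ b) bC _] /bC /andP[_ /eqP lb].
  apply/subsetP=> x /(imset_f lam); rewrite lb inE => /eqP /hP [i ->].
  exact: codom_f.
apply: eq_card => D; rewrite !inE; congr andb.
  apply/forall_inP/forall_inP => D3 b bD.
    have /andP[/andP[]] := D3 _ (imset_f _ bD).
    by rewrite card_imset.
  case/imsetP: bD => c cD ->; have c3 := D3 _ cD.
  rewrite /lam_block card_imset // c3 big1 /= ?eqxx; last first.
    by move=> _ /imsetP[i _ ->].
  apply/eqP/setP=> a; rewrite inE; apply/imsetP/eqP => [[_ /imsetP[i _ ->] ->] //|->].
  have /card_gt0P[i ic] : 0 < #|c| by rewrite (eqP c3).
  by exists (h i); rewrite ?lamh ?imset_f.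
apply/forallP/forallP => D1 x.
  apply/forallP=> y; apply/implyP=> xy.
  move/forallP/(_ (h y)): (D1 (h x)); rewrite inj_eq // xy /pair_type !lamh addr0 !setUid eqxx /=.
  by rewrite blocks_through_image.
apply/forallP=> y; apply/implyP=> xy; apply/implyP=> /eqP /setP pt.
have lx : lam x = 0%R by apply/eqP; have := pt (lam x); rewrite !inE eqxx.
have ly : lam y = 0%R by apply/eqP; have := pt (lam y); rewrite !inE eqxx orbT.
have [i xE] := hP _ lx; have [j yE] := hP _ ly.
move: xy; rewrite xE yE blocks_through_image // inj_eq // => ij.
by move/forallP/(_ j): (D1 i); rewrite ij.
Qed.

End TypeCounts.

(** * 1-factorizations with indexed factors *)

Section LabelledFactorizations.
Variables (k g : nat).
Implicit Types (phi : {ffun 'I_k -> {set {set 'I_g}}}) (f : {set {set 'I_g}}) (e : {set 'I_g}).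

Lemma is_one_factorE f : is_one_factor f =
  [forall e in f, #|e| == 2] && [forall x, #|[set e in f | x \in e]| == 1].
Proof.
rewrite /is_one_factor; have -> : (f \subset complete_edges 'I_g) = [forall e in f, #|e| == 2].
  by apply/subsetP/forall_inP=> f2 e /f2; rewrite inE.
case f2: [forall e in f, _] => //=; rewrite partition_unique.
  by apply: eq_forallb => x; rewrite inE.
move=> e ef; rewrite subsetT -card_gt0; move/forall_inP: f2 => /(_ e ef).
by move=> /eqP->.
Qed.

(** There are [g.-1 * n] edges in all, and each factor uses [n] of them. *)
Lemma card_one_factorization n (F : {set {set {set 'I_g}}}) : g = n.*2 -> 0 < n ->
  is_one_factorization F -> #|F| = g.-1.
Proof.
move=> gE n0 /andP[/forall_inP F1 pF].
have Fn f : f \in F -> #|f| = n.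
  case/F1/andP=> /subsetP f2 pf; apply: double_inj.
  rewrite -gE -[RHS]card_ord -cardsT (@card_uniform_partition _ 2 _ _ _ pf) ?muln2 //.
  by move=> e /f2; rewrite inE => /eqP.
have C2 : 'C(g, 2) = g.-1 * n by rewrite bin2 gE -doubleMl doubleK mulnC.
have /eqP := card_uniform_partition Fn pF.
by rewrite card_draws card_ord C2 eqn_pmul2r // => /eqP.
Qed.

(** An index will stand for a point of the zero fibre, and [phi i] for the edges that complete this
    point to blocks. *)
Definition labelled_factorization phi :=
  [forall i, is_one_factor (phi i)] &&
  [forall e in complete_edges 'I_g, #|[set i | e \in phi i]| == 1].

Lemma one_factor_neq0 f : 0 < g -> is_one_factor f -> f != set0.
Proof.
move=> g0; rewrite is_one_factorE => /andP[_ /forallP/(_ (Ordinal g0))].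
by apply: contraL => /eqP->; rewrite (_ : [set _ in _ | _] = set0) ?cards0 //;
  apply/setP=> e; rewrite !inE.
Qed.

(** Injectivity comes for free: equal factors would give each of their edges two indices, and a
    factor on a nonempty vertex set has an edge. *)
Lemma labelled_factorizationE phi : 0 < g ->
  labelled_factorization phi
  = injectiveb phi && is_one_factorization [set phi i | i in 'I_k].
Proof.
move=> g0; have imE e : injective phi ->
    #|[set f in [set phi i | i in 'I_k] | e \in f]| = #|[set i | e \in phi i]|.
  move=> injphi; rewrite -(card_imset _ injphi); apply: eq_card => f.
  rewrite inE; apply/andP/imsetP => [[/imsetP[i _ ->] ei]|[i]].
    by exists i; rewrite // inE.
  by rewrite inE => ei ->; rewrite imset_f.
have factE : [forall i, is_one_factor (phi i)]
    = [forall f in [set phi i | i in 'I_k], is_one_factor f].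
  apply/forallP/forall_inP => [fphi _ /imsetP[i _ ->] //|fphi i].
  by apply: fphi; rewrite imset_f.
rewrite /labelled_factorization /is_one_factorization -factE.
case fphi: [forall i, _] => /=; last by rewrite andbF.
rewrite partition_unique; last first.
  move=> _ /imsetP[i _ ->]; move/forallP/(_ i): fphi => fi.
  by rewrite one_factor_neq0 // andbT; case/andP: fi.
apply/forall_inP/andP => [e1|[/injectiveP injphi] /forall_inP e1 e eE]; last first.
  by rewrite -imE // e1.
suff injphi : injective phi.
  by split; [apply/injectiveP | apply/forall_inP=> e /e1; rewrite imE].
move=> i i' phiE; move/forallP/(_ i): fphi => fi.
have /set0Pn[e ei] := one_factor_neq0 g0 fi.
have eE : e \in complete_edges 'I_g by case/andP: fi => /subsetP/(_ e ei).
have /cards1P[i0 /setP E] := e1 _ eE.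
have := E i; have := E i'; rewrite !inE -phiE ei => /esym/eqP-> /esym/eqP->.
by [].
Qed.

End LabelledFactorizations.

Lemma card_labelled_factorization n g : g = n.*2 -> 0 < n ->
  #|[set phi : {ffun 'I_g.-1 -> {set {set 'I_g}}} | labelled_factorization phi]|
  = num_one_factorizations g * g.-1`!.
Proof.
move=> gE n0; have g0 : 0 < g by rewrite gE double_gt0.
under eq_finset => phi do rewrite labelled_factorizationE //.
rewrite -sum1dep_card (partition_big (fun phi : {ffun _ -> _} => [set phi i | i in 'I_g.-1])
  (@is_one_factorization _)) /=; last by move=> phi /andP[].
rewrite /num_one_factorizations cardsE -sum_nat_const; apply: eq_bigr => F OF.
 rewrite sum1dep_card; have cF := card_one_factorization gE n0 OF.
transitivity #|[set f in ffun_on (mem F) | injectiveb (f : {ffun 'I_g.-1 -> _})]|; last first.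
  by rewrite card_inj_ffuns_on card_ord /= cF ffactnn.
apply: eq_card => phi; rewrite !inE.
apply/andP/andP => [[/andP[injphi _] /eqP <-]|[/ffun_onP phiF injphi]].
  by split=> //; apply/ffun_onP=> i; rewrite /= imset_f.
have -> : [set phi i | i in 'I_g.-1] = F.
  apply/eqP; rewrite eqEcard card_imset ?card_ord ?cF ?leqnn ?andbT; last exact/injectiveP.
  by apply/subsetP=> _ /imsetP[i _ ->]; apply: phiF.
by rewrite injphi OF eqxx.
Qed.

(** * Type {0, a}: labelled 1-factorizations of a nonzero fibre *)

Section PairType.
Variables (V : finType) (L : finZmodType) (lam : V -> L).
Hypothesis char2 : forall a : L, (a + a = 0)%R.

(** A block of this type is a point of the zero fibre together with an edge of the fibre of [a]. A
    mixed pair lies in one block iff the point's edges cover the other point once; a pair inside the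
    fibre of [a] lies in one block iff this edge has one index. *)
Lemma card_type_pair a n g : a != 0%R -> g = n.*2 -> 0 < n ->
  #|fibre lam 0%R| = g.-1 -> #|fibre lam a| = g ->
  #|[set C | type_design lam [set 0%R; a] C]| = num_one_factorizations g * g.-1`!.
Proof.
move=> a0 gE n0 /enum_set_bij[h injh hE] /enum_set_bij[q injq qE].
rewrite -(card_labelled_factorization gE n0).
have lamh i : lam (h i) = 0%R.
  have : h i \in fibre lam 0%R by rewrite hE imset_f.
  by rewrite inE => /eqP.
have lamq i : lam (q i) = a.
  have : q i \in fibre lam a by rewrite qE imset_f.
  by rewrite inE => /eqP.
have hP x : lam x = 0%R -> exists i, x = h i.
  move=> lx; have : x \in fibre lam 0%R by rewrite inE lx.
  by rewrite hE => /imsetP[i _ ->]; exists i.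
have qP x : lam x = a -> exists i, x = q i.
  move=> lx; have : x \in fibre lam a by rewrite inE lx.
  by rewrite qE => /imsetP[i _ ->]; exists i.
have hq i j : (h i == q j) = false.
  by apply: contraNF a0 => /eqP E; rewrite -(lamq j) -E lamh.
pose blk (p : 'I_g.-1 * {set 'I_g}) : {set V} := h p.1 |: q @: p.2.
have hblk i p : (h i \in blk p) = (i == p.1).
  rewrite !inE inj_eq //; case: eqP => //= _.
  by apply/imsetP=> [[j _ /eqP]]; rewrite hq.
have qblk j p : (q j \in blk p) = (j \in p.2).
  by rewrite !inE eq_sym hq mem_imset.
have injblk : injective blk.
  move=> [i e] [i' e'] E; have := hblk i (i, e); rewrite E hblk eqxx /= => /eqP <-.
  by congr pair; apply/setP=> j; have := qblk j (i, e); rewrite E qblk.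
rewrite (card_transport injblk); last first.
  move=> C /andP[/forall_inP C1 _]; apply/subsetP=> b /C1 /andP[lb /eqP lb0].
  have /imsetP[x xb lx] : 0%R \in lam @: b by rewrite lb0 set21.
  have /imsetP[y yb ly] : a \in lam @: b by rewrite lb0 set22.
  have xy : x != y by apply: contraNneq a0 => E; rewrite ly -E -lx.
  have [z [-> _ _ lz]] := lam_block_pair char2 lb xb yb xy.
  move: lz; rewrite -lx -ly add0r => /qP[l ->].
  have [i ->] := hP _ (esym lx); have [j ->] := qP _ (esym ly).
  apply/codomP; exists (i, [set j; l]).
  by rewrite /blk /= imsetU1 imset_set1 setUA.
(* Uncurrying: a set of pairs (point, edge) is the same as an edge set for each point. *)
pose psi (phi : {ffun 'I_g.-1 -> {set {set 'I_g}}}) := [set p | p.2 \in phi p.1].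
have injpsi : injective psi.
  move=> phi phi' /setP E; apply/ffunP=> i; apply/setP=> e.
  by have := E (i, e); rewrite !inE.
rewrite -(card_imset _ injpsi); apply: eq_card => G; rewrite inE.
suff key phi : type_design lam [set 0%R; a] (blk @: psi phi) = labelled_factorization phi.
  apply/idP/imsetP => [GP|[phi]]; last by rewrite inE -key => ? ->.
  have GE : G = psi [ffun i => [set e | (i, e) \in G]].
    by apply/setP=> -[i e]; rewrite !inE ffunE inE.
  by exists [ffun i => [set e | (i, e) \in G]]; rewrite // inE -key -GE.
have T1 p : lam_block lam (blk p) && (lam @: blk p == [set 0%R; a]) = (#|p.2| == 2).
  rewrite /lam_block cardsU1 card_imset // -[#|p.2| == 2]eqSS.
  have -> : h p.1 \notin q @: p.2.
    by apply/imsetP=> [[j _ /eqP]]; rewrite hq.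
  rewrite add1n; case: eqP => //= -[p2]; apply/andP; split.
    rewrite big_setU1 /=; last by apply/imsetP=> [[j _ /eqP]]; rewrite hq.
    rewrite big_imset /=; last by move=> ? ? _ _; apply: injq.
    by rewrite (eq_bigr (fun=> a)) // lamh add0r sumr_const p2 mulr2n char2.
  rewrite imsetU1 lamh -imset_comp; apply/eqP; congr setU.
  apply/setP=> b; rewrite inE; apply/imsetP/eqP => [[j _ ->]|->] //=.
  have /card_gt0P[j jp] : 0 < #|p.2| by rewrite p2.
  by exists j.
have thr_hq i j :
    #|blocks_through (blk @: psi phi) (h i) (q j)| = #|[set e in phi i | j \in e]|.
  have inji : injective (fun e => blk (i, e)) by move=> e e' /injblk[].
  rewrite -(card_imset _ inji); apply: eq_card => b; rewrite inE.
  apply/andP/imsetP => [[/imsetP[[i' e] +] ->]|[e]].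
    rewrite inE hblk qblk /= => ephi /andP[/eqP -> je].
    by exists e; rewrite // inE ephi.
  rewrite inE => /andP[ephi je] ->; rewrite hblk qblk eqxx je.
  by rewrite imset_f // inE.
have thr_qq j l : (forall i e, e \in phi i -> #|e| == 2) -> j != l ->
    #|blocks_through (blk @: psi phi) (q j) (q l)|
    = #|[set i | [set j; l] \in phi i]|.
  move=> phi2 jl.
  have inje : injective (fun i => blk (i, [set j; l])) by move=> e e' /injblk[].
  rewrite -(card_imset _ inje); apply: eq_card => b; rewrite inE.
  apply/andP/imsetP => [[/imsetP[[i e] +] ->]|[i]].
    rewrite inE !qblk /= => ephi /andP[je le]; exists i; rewrite ?inE.
      rewrite (_ : [set j; l] = e) //; apply/eqP.
      by rewrite eqEcard subUset !sub1set je le cards2 jl (eqP (phi2 _ _ ephi)).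
    rewrite (_ : [set j; l] = e) //; apply/eqP.
    by rewrite eqEcard subUset !sub1set je le cards2 jl (eqP (phi2 _ _ ephi)).
  rewrite inE => ephi ->; rewrite !qblk set21 set22.
  by rewrite imset_f // inE.
have labE : labelled_factorization phi =
    [&& [forall i, forall e in phi i, #|e| == 2],
        [forall i, forall x, #|[set e in phi i | x \in e]| == 1] &
        [forall e in complete_edges 'I_g, #|[set i | e \in phi i]| == 1]].
  rewrite /labelled_factorization andbA; congr andb.
  apply/forallP/andP => [P|[/forallP P1 /forallP P2] i].
    by split; apply/forallP=> i; have := P i; rewrite is_one_factorE => /andP[].
  by rewrite is_one_factorE P1 P2.
have E1 : [forall b in blk @: psi phi, lam_block lam b && (lam @: b == [set 0%R; a])]
    = [forall i, forall e in phi i, #|e| == 2].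
  apply/forall_inP/forallP => [P i|P b /imsetP[p]].
    apply/forall_inP=> e ei; have /imset_f : (i, e) \in psi phi by rewrite inE.
    by move/(_ _ blk)/P; rewrite T1.
  by rewrite inE => pphi ->; rewrite T1; move/forall_inP: (P p.1); apply.
rewrite /type_design labE E1.
case phi2: [forall i, forall e in phi i, #|e| == 2] => //=.
have {phi2} phi2 i e : e \in phi i -> #|e| == 2.
  by move/forallP: phi2 => /(_ i)/forall_inP; apply.
apply/forallP/andP => [P|[/forallP Phq /forall_inP Pqq] x].
  split; apply/forallP.
    move=> i; apply/forallP=> j; move/forallP/(_ (q j)): (P (h i)).
    by rewrite hq thr_hq /pair_type lamh lamq add0r -setUA setUid eqxx.
  move=> e; apply/implyP; rewrite inE => /cards2P[j [l [jl ->]]].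
  move/forallP/(_ (q l)): (P (q j)).
  by rewrite inj_eq // jl thr_qq // /pair_type !lamq char2 setUid setUC eqxx.
apply/forallP=> y; apply/implyP=> xy; apply/implyP=> /eqP pt.
(* Only the labels (0, a), (a, 0) and (a, a) give this type; two zero labels would lose [a]. *)
have /orP[/eqP lx|/eqP lx] : (lam x == 0%R) || (lam x == a).
- by have := set21 (lam x) (lam y); rewrite -in_set2 -pt /pair_type !inE eqxx.
- have [i xE] := hP _ lx.
  have /orP[/eqP ly|/eqP ly] : (lam y == 0%R) || (lam y == a).
  + by rewrite -in_set2 -pt /pair_type !inE eqxx orbT.
  + move/setP/(_ a): pt; rewrite /pair_type lx ly addr0 !inE eqxx orbT.
    by rewrite (negPf a0).
  have [j yE] := qP _ ly; rewrite xE yE thr_hq.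
  by move/forallP: (Phq i); apply.
have [j xE] := qP _ lx.
have /orP[/eqP ly|/eqP ly] : (lam y == 0%R) || (lam y == a).
- by rewrite -in_set2 -pt /pair_type !inE eqxx orbT.
- have [i yE] := hP _ ly; rewrite xE yE.
  rewrite (_ : blocks_through _ _ _ = blocks_through (blk @: psi phi) (h i) (q j)).
    by rewrite thr_hq; move/forallP: (Phq i); apply.
  by apply/setP=> b; rewrite !inE (andbC (q j \in b)).
have [l yE] := qP _ ly; move: xy; rewrite xE yE inj_eq // => jl.
rewrite thr_qq //; apply: Pqq; rewrite inE cards2 jl.
by [].
Qed.

End PairType.

(** * Lines of the projective space over GF(2) *)

Section Lines.
Variable L : finZmodType.
Hypothesis char2 : forall a : L, (a + a = 0)%R.

Definition lines : {set {set L}} := [set j | lam_block id j & 0%R \notin j].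

Lemma line_pair j a b : j \in lines -> a \in j -> b \in j -> a != b ->
  pair_type id a b = j.
Proof.
rewrite inE => /andP[lj _] aj bj ab.
by rewrite -(lam_block_type char2 lj aj bj ab) imset_id.
Qed.

Lemma pair_type_line a b : a != 0%R -> b != 0%R -> a != b -> pair_type id a b \in lines.
Proof.
move=> a0 b0 ab.
have ab_a : (a + b == a)%R = false by rewrite -subr_eq0 addrC addKr (negPf b0).
have ab_b : (a + b == b)%R = false by rewrite -subr_eq0 addrK (negPf a0).
have ab0 : (a + b == 0)%R = false by rewrite addr_eq0 (oppr_self char2) (negPf ab).
rewrite inE /lam_block /pair_type setUC cardsU1 cards2 ab !inE ab_a ab_b /=.
rewrite (eq_sym _ a) (eq_sym _ b) (eq_sym _ (a + b)%R) (negPf a0) (negPf b0) ab0 andbT.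
by rewrite !big_setU1 ?inE ?ab_a ?ab_b //= big_set1 char2.
Qed.

(** Double counting of ordered pairs of distinct nonzero vectors: each spans one line, and each line
    contains 3 * 2 such pairs. *)
Lemma card_lines : #|lines| * 6 = #|L|.-1 * #|L|.-2.
Proof.
pose S := [set p : L * L | [&& p.1 != 0%R, p.2 != 0%R & p.1 != p.2]].
have offdiag (A : {set L}) :
    #|[set p : L * L | [&& p.1 \in A, p.2 \in A & p.1 != p.2]]| = #|A| * #|A|.-1.
  rewrite -sum1dep_card.
  rewrite -(pair_big_dep (fun a => a \in A) (fun a b => (b \in A) && (a != b)) (fun _ _ => 1)) /=.
  rewrite -sum_nat_const; apply: eq_bigr => a aA.
  rewrite sum1dep_card [in RHS](cardsD1 a) aA /=; apply: eq_card => b.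
  by rewrite !inE andbC (eq_sym a).
have -> : #|L|.-1 * #|L|.-2 = #|S|.
  have := offdiag [set~ 0%R]; rewrite cardsC1 => <-; apply: eq_card => p.
  by rewrite !inE.
rewrite -[in RHS]sum1dep_card (partition_big (fun p => pair_type id p.1 p.2) (mem lines)) /=; last first.
  by move=> p /and3P[*]; apply: pair_type_line.
rewrite -sum_nat_const; apply: eq_bigr => j jl; rewrite sum1dep_card.
have /andP[/andP[/eqP j3 _] j0] : lam_block id j && (0%R \notin j) by move: jl; rewrite inE.
have E := offdiag j; rewrite j3 in E; apply: etrans (esym E) _; apply: eq_card => -[a b]; rewrite !inE /=.
apply/and3P/andP => [[aj bj ab]|[/and3P[a0 b0 ab] /eqP <-]]; last first.
  by rewrite !inE !eqxx orbT.
split; last by rewrite (line_pair jl aj bj ab).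
by rewrite ab andbT; apply/andP; split; apply: contraNneq j0 => <-.
Qed.

End Lines.

(** * Type a line: transversal designs on three fibres *)

Section LineType.
Variables (V : finType) (L : finZmodType) (lam : V -> L).
Hypothesis char2 : forall a : L, (a + a = 0)%R.

(** The three fibres over the line become the three groups. Since 0 is not on the line, the pairs of
    this type are exactly the pairs from two different groups. *)
Lemma card_type_line (j : {set L}) g : j \in lines L ->
  (forall a, a \in j -> #|fibre lam a| = g) ->
  #|[set C | type_design lam j C]| = num_TD3 g.
Proof.
move=> jl fj; have /andP[/andP[/eqP j3 sj] j0] : lam_block id j && (0%R \notin j) by move: jl; rewrite inE.
have [a inja jE] := enum_set_bij j3.
have jT : j = a @: [set: 'I_3].
  by rewrite jE; apply/setP=> b; apply/imsetP/imsetP => -[i _ ->]; exists i.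
have aj i : a i \in j by rewrite jE imset_f.
have [h injh hE] := fin_all_exists2 (fun i => enum_set_bij (fj _ (aj i))).
pose H (p : 'I_3 * 'I_g) := h p.1 p.2.
have lamH p : lam (H p) = a p.1.
  have : H p \in fibre lam (a p.1) by rewrite hE /H imset_f.
  by rewrite inE => /eqP.
have injH : injective H.
  move=> [i k] [i' k'] E; have := lamH (i, k); rewrite E lamH => /inja /= ii.
  by move: E; rewrite ii /H /= => /injh ->.
have HP x : lam x \in j -> exists p, x = H p.
  rewrite {1}jE => /imsetP[i _ lx].
  have : x \in fibre lam (a i) by rewrite inE lx.
  by rewrite hE => /imsetP[k _ ->]; exists (i, k).
rewrite (card_image_blocks injH); last first.
  move=> C b /andP[/forall_inP/(_ b) bC _] /bC /andP[_ /eqP lb].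
  apply/subsetP=> x /(imset_f lam); rewrite lb => /HP[p ->]; exact: codom_f.
have blockE (c : {set 'I_3 * 'I_g}) :
    lam_block lam (H @: c) && (lam @: (H @: c) == j)
    = (#|c| == 3) && [forall i, #|c :&: TD_group g i| == 1].
  have -> : lam @: (H @: c) = a @: (fst @: c).
    by rewrite -!imset_comp; apply: eq_imset => p /=; rewrite lamH.
  have imE (A A' : {set 'I_3}) : (a @: A == a @: A') = (A == A').
    exact: (inj_eq (imset_inj inja)).
  rewrite [in LHS]jT imE /lam_block card_imset // -andbA.
  case: eqP => //= c3.
  (* A 3-set meets every group once iff its projection to ['I_3] is onto; the projection is then
     injective on it, and the label sum is the sum of the line, which is 0. *)
  have -> : [forall i, #|c :&: TD_group g i| == 1] = (fst @: c == setT).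
    apply/forallP/eqP => [c1|c1 i].
      apply/setP=> i; rewrite !inE; apply/imsetP.
      by have /cards1P[p /setP/(_ p)] := c1 i; rewrite !inE eqxx => /andP[? /eqP<-]; exists p.
    have /imset_injP injc : #|fst @: c| == #|c| by rewrite c1 c3 cardsT card_ord.
    have /imsetP[p pc pi] : i \in fst @: c by rewrite c1 inE.
    apply/cards1P; exists p; apply/setP=> q; rewrite !inE.
    apply/andP/eqP => [[qc /eqP qi]|->]; last by rewrite pc -pi eqxx.
    by apply: injc; rewrite // qi.
  apply/andb_idl => /eqP c1.
  have /imset_injP injc : #|fst @: c| == #|c| by rewrite c1 c3 cardsT card_ord.
  rewrite big_imset /=; last by move=> ? ? _ _; apply: injH.
  rewrite (eq_bigr (a \o fst)) => [|p _]; last by rewrite lamH.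
  rewrite -(big_imset a injc) c1; by move: sj; rewrite jT big_imset //= => ? ? _ _; apply: inja.
apply: eq_card => D; rewrite !inE; congr andb.
  apply/forall_inP/forall_inP => [P b bD|P _ /imsetP[c cD ->]].
    by rewrite -blockE P // imset_f.
  by rewrite blockE P.
apply/forallP/forallP => D1 x.
  apply/forallP=> y; apply/implyP=> xy; move/forallP/(_ (H y)): (D1 (H x)).
  have Hxy : lam (H x) != lam (H y) by rewrite !lamH inj_eq.
  have -> : pair_type lam (H x) (H y) = j.
    by apply: (line_pair char2 jl _ _ Hxy); rewrite lamH aj.
  rewrite eqxx blocks_through_image // inj_eq //.
  by rewrite (contraNneq _ xy) // => ->.
apply/forallP=> y; apply/implyP=> xy; apply/implyP=> /eqP pt.
have lx : lam x \in j by rewrite -pt !inE eqxx.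
have ly : lam y \in j by rewrite -pt !inE eqxx orbT.
have lxy : lam x != lam y.
  apply: contraNneq j0 => E; rewrite -pt /pair_type E char2 !inE eqxx.
  by rewrite !orbT.
have [p xE] := HP _ lx; have [q yE] := HP _ ly.
move: lxy; rewrite xE yE blocks_through_image // !lamH inj_eq // => pq.
by move/forallP/(_ q): (D1 p); rewrite pq.
Qed.

End LineType.

(** * The number of systems compatible with a labelling *)

Section CompatibleCount.
Variables (V : finType) (L : finZmodType) (lam : V -> L).
Hypothesis char2 : forall a : L, (a + a = 0)%R.

Definition zero_pairs : {set {set L}} := [set [set 0%R; a] | a in [set~ 0%R]].

(** The cases are a zero label, two equal nonzero labels (which sum to 0), and two distinct nonzero
    labels. *)
Lemma pair_type_cases x y :
  pair_type lam x y \in [set 0%R] |: (zero_pairs :|: lines L).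
Proof.
have [lx0|lx0] := eqVneq (lam x) 0%R.
  have [ly0|ly0] := eqVneq (lam y) 0%R.
    by rewrite /pair_type lx0 ly0 addr0 !setUid setU11.
  rewrite !inE; apply/orP; right; apply/orP; left; apply/imsetP.
  by exists (lam y); rewrite ?inE // /pair_type lx0 add0r -setUA setUid.
have [ly0|ly0] := eqVneq (lam y) 0%R.
  rewrite !inE; apply/orP; right; apply/orP; left; apply/imsetP.
  by exists (lam x); rewrite ?inE // /pair_type ly0 addr0 setUAC setUid setUC.
have [lxy|lxy] := eqVneq (lam x) (lam y).
  rewrite !inE; apply/orP; right; apply/orP; left; apply/imsetP.
  by exists (lam x); rewrite ?inE // /pair_type -lxy char2 setUid setUC.
by rewrite in_setU1 in_setU (pair_type_line char2 lx0 ly0 lxy) !orbT.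
Qed.

(** No block and no pair has such a type, so the empty design is the only one and the factor in the
    product is 1. *)
Lemma card_type_other j : j \notin [set 0%R] |: (zero_pairs :|: lines L) ->
  #|[set C | type_design lam j C]| = 1.
Proof.
move=> jJ; apply/eqP/cards1P; exists set0; apply/setP=> C; rewrite !inE.
apply/idP/eqP => [/andP[/forall_inP C1 _]|->].
  apply: contraNeq jJ => /set0Pn[b /C1 /andP[lb /eqP <-]].
  have [/eqP b3 _] := andP lb.
  have [x xb] : exists x, x \in b by apply/card_gt0P; rewrite b3.
  have [y] : exists y, y \in b :\ x.
    by apply/card_gt0P; have := cardsD1 x b; rewrite b3 xb add1n => -[<-].
  rewrite in_setD1 (eq_sym y) => /andP[xy yb].
  by rewrite (lam_block_type char2 lb xb yb xy) pair_type_cases.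
apply/andP; split; first by apply/forall_inP=> b; rewrite inE.
apply/forallP=> x; apply/forallP=> y; apply/implyP=> _; apply/implyP=> /eqP E.
by rewrite -E pair_type_cases in jJ.
Qed.

Lemma card_compatible_STS_formula n g : g = n.*2 -> 0 < n ->
  #|fibre lam 0%R| = g.-1 -> (forall a, a != 0%R -> #|fibre lam a| = g) ->
  #|[set B | compatible_STS lam B]|
  = num_STS g.-1 * (num_one_factorizations g * g.-1`!) ^ #|L|.-1
    * num_TD3 g ^ (#|L|.-1 * #|L|.-2 %/ 6).
Proof.
move=> gE n0 f0 fa; rewrite card_compatible_STS //.
pose F j := #|[set C | type_design lam j C]|.
have injp : {in [set~ 0%R] &, injective (fun a : L => [set 0%R; a])}.
  move=> a b; rewrite !inE => a0 b0 /setP/(_ a); rewrite !inE eqxx orbT (negPf a0).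
  by move=> /esym/eqP.
transitivity (\prod_(j in [set 0%R] |: (zero_pairs :|: lines L)) F j).
  rewrite big_mkcond [RHS]big_mkcond; apply: eq_bigr => j _ /=.
  by case: ifP => // /negbT /card_type_other.
rewrite big_setU1 /=; last first.
  rewrite !in_setU !negb_or; apply/andP; split.
  - apply/imsetP=> -[a]; rewrite !inE => a0 /setP/(_ a).
    by rewrite !inE eqxx orbT (negPf a0).
  - by rewrite inE /lam_block cards1.
rewrite /F (card_type_zero f0) -mulnA; congr muln.
rewrite (eq_bigl [predU zero_pairs & lines L]); last by move=> j; rewrite !inE.
rewrite bigU /=; last first.
  rewrite disjoint_subset; apply/subsetP=> _ /imsetP[a _ ->].
  by rewrite !inE eqxx andbF.
congr muln.
  rewrite /zero_pairs big_imset //= -(cardsC1 (0%R : L)) -prod_nat_const.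
  by apply: eq_bigr => a; rewrite !inE => a0; rewrite (card_type_pair char2 a0 gE n0 f0) // fa.
rewrite -card_lines // mulnK // -prod_nat_const; apply: eq_bigr => j jl.
apply: card_type_line => // a aj; apply: fa; apply: contraTneq aj => ->.
by move: jl; rewrite inE => /andP[].
Qed.

End CompatibleCount.

(** * Third points and the sizes of occupied fibres *)

Section ThirdPoint.
Variables (V : finType) (L : finZmodType) (lam : V -> L) (B : {set {set V}}).
Hypotheses (char2 : forall a : L, (a + a = 0)%R) (cB : compatible_STS lam B).

Lemma compatible_block b : b \in B -> lam_block lam b.
Proof. by case/andP: cB => _ /forall_inP; apply. Qed.

Lemma block_uniq b c x y : x != y -> b \in B -> c \in B ->
  x \in b -> y \in b -> x \in c -> y \in c -> b = c.
Proof.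
move=> xy bB cB' xb yb xc yc; case/andP: cB => /andP[_ /forallP/(_ x)/forallP/(_ y)] + _.
rewrite xy => /cards1P[d /setP E].
by have := E b; have := E c; rewrite !inE bB cB' xb yb xc yc => /esym/eqP-> /esym/eqP->.
Qed.

(** The default [x] is never reached when [x != y], as [thirdP] shows. *)
Definition third x y := odflt x [pick z | [&& z != x, z != y & [set x; y; z] \in B]].

Lemma thirdP x y : x != y -> [/\ third x y != x, third x y != y,
  [set x; y; third x y] \in B & lam (third x y) = (lam x + lam y)%R].
Proof.
move=> xy; case/andP: (cB) => /andP[_ /forallP/(_ x)/forallP/(_ y)] + _.
rewrite xy => /cards1P[b /setP/(_ b)]; rewrite !inE eqxx => /and3P[bB xb yb].
have [z [bE zx zy lz]] := lam_block_pair char2 (compatible_block bB) xb yb xy.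
rewrite /third; case: pickP => [z' /and3P[z'x z'y z'B] |/(_ z)] /=; last first.
  by rewrite zx zy -bE bB.
split=> //; rewrite -lz; congr lam.
have := block_uniq xy z'B bB; rewrite !inE !eqxx ?orbT xb yb => /(_ isT isT isT isT)/setP/(_ z').
by rewrite bE !inE eqxx (negPf z'x) (negPf z'y) => /esym/eqP.
Qed.

Lemma thirdK x y : x != y -> third x (third x y) = y.
Proof.
move=> xy; have [zx zy bB _] := thirdP xy; set z := third x y in zx zy bB *.
have xz : x != z by rewrite eq_sym.
have [wx wz cB' _] := thirdP xz; set w := third x z in wx wz cB' *.
have /setP/(_ w) : [set x; z; w] = [set x; y; z].
  by apply: (block_uniq xz); rewrite // !inE eqxx ?orbT.
by rewrite !inE eqxx orbT (negPf wx) (negPf wz) orbF => /esym/eqP.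
Qed.

(** Completing blocks through [x] is an involution on the other points that adds [lam x] to labels,
    so it exchanges these two sets. *)
Lemma card_fibre_shift x a :
  #|fibre lam a :\ x| = #|fibre lam (lam x + a)%R :\ x|.
Proof.
suff le a' : #|fibre lam a' :\ x| <= #|fibre lam (lam x + a')%R :\ x|.
  apply/eqP; rewrite eqn_leq le /=.
  by have := le (lam x + a)%R; rewrite addrA char2 add0r.
have inj3 : {in fibre lam a' :\ x &, injective (third x)}.
  move=> y z; rewrite !in_setD1 => /andP[yx _] /andP[zx _] E.
  by rewrite -(@thirdK x y) 1?eq_sym // E thirdK // eq_sym.
rewrite -(card_in_imset inj3); apply/subset_leq_card/subsetP=> z /imsetP[y].
rewrite in_setD1 inE => /andP[yx /eqP ly] ->.
by rewrite eq_sym in yx; have [tx _ _ lt] := thirdP yx; rewrite in_setD1 inE tx lt ly /=.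
Qed.

(** Apply the shift with [a = 0]: deleting [x] costs its own fibre one point and the zero fibre
    none. *)
Lemma card_fibre_occupied x : lam x != 0%R ->
  #|fibre lam (lam x)| = #|fibre lam 0%R|.+1.
Proof.
move=> x0; have E := card_fibre_shift x 0%R; rewrite addr0 in E.
rewrite (cardsD1 x) -E inE eqxx add1n; congr _.+1.
by apply: eq_card => y; rewrite !inE; case: (eqVneq y x) => // ->; rewrite (negPf x0).
Qed.

End ThirdPoint.

Lemma addrr_F2 (c : 'F_2) : (c + c = 0)%R.
Proof. by rewrite -mulr2n -mulr_natr pchar_Fp_0 // mulr0. Qed.

Lemma F2_cases (c : 'F_2) : c = 0%R \/ c = 1%R.
Proof. by case: c => [[|[|c]] // ?]; [left|right]; apply/val_inj. Qed.

Lemma addrr_rV2 m (u : 'rV['F_2]_m) : (u + u = 0)%R.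
Proof. by apply/rowP=> i; rewrite !mxE addrr_F2. Qed.

(** * Extending the labelling by a further dual word *)

Section Extension.
Variables (V : finType) (m : nat) (lam : V -> 'rV['F_2]_m) (B : {set {set V}}).
Hypothesis cB : compatible_STS lam B.
Variables (n g : nat).
Hypotheses (gE : g = n.*2) (n0 : 0 < n).
Hypothesis fibre0 : #|fibre lam 0%R| = g.-1.
Hypothesis fibreN0 : forall a, a != 0%R -> #|fibre lam a| = g.
Variable f : V -> 'F_2.
Hypothesis fB : forall b, b \in B -> (\sum_(x in b) f x = 0)%R.

Definition extend_label x : 'rV['F_2]_(m + 1) := row_mx (lam x) (f x)%:M.

Lemma compatible_extend : compatible_STS extend_label B.
Proof.
case/andP: cB => sB /forall_inP lB; rewrite /compatible_STS sB /=.
apply/forall_inP=> b bB; have /andP[b3 /eqP lb] := lB _ bB; rewrite /lam_block b3 /=.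
apply/eqP/rowP=> i; rewrite summxE mxE.
transitivity ((row_mx (\sum_(x in b) lam x) (\sum_(x in b) f x)%:M : 'rV_(m + 1)) ord0 i)%R.
  rewrite mxE; under eq_bigr do rewrite mxE.
  case: (split i) => k; rewrite ?summxE // mxE !ord1 mulr1n.
  by apply: eq_bigr => x _; rewrite mxE mulr1n.
by rewrite lb fB // !mxE; case: split => k; rewrite !mxE ?mul0rn.
Qed.

Lemma third_label x y : x != y -> exists z,
  lam z = (lam x + lam y)%R /\ f z = (f x + f y)%R.
Proof.
move=> xy; have [_ _ _] := thirdP (@addrr_rV2 _) compatible_extend xy.
rewrite /extend_label add_row_mx => /eq_row_mx[lz /matrixP/(_ ord0 ord0)].
by rewrite !mxE !mulr1n => fz; exists (third B x y).
Qed.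

(* f is constant on the fibres of lam, because the third point of two points of
   one fibre is labelled 0, and it is additive by the same argument. *)
Lemma functional_of_label : (forall x, lam x = 0%R -> f x = 0%R) ->
  exists w : 'I_m -> 'F_2, forall x, f x = (\sum_i lam x ord0 i * w i)%R.
Proof.
move=> f0.
(* The value of [f] on a fibre; the default 0 gives [phi 0 = 0] without asking whether the zero
   fibre is occupied. *)
pose phi a : 'F_2 := if [pick x | lam x == a] is Some x then f x else 0%R.
have phi0 : phi 0%R = 0%R by rewrite /phi; case: pickP => // x /eqP /f0.
have phiP x : phi (lam x) = f x.
  rewrite /phi; case: pickP => [y /eqP E|/(_ x)]; last by rewrite eqxx.
  have [->//|yx] := eqVneq y x.
  have [z []] := third_label yx; rewrite E addrr_rV2 => /f0 -> /esym/eqP.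
  by rewrite addr_eq0 (oppr_self addrr_F2) => /eqP.
have occ a : a != 0%R -> exists x, lam x = a.
  move=> a0; have /card_gt0P[x] : 0 < #|fibre lam a| by rewrite fibreN0 // gE double_gt0.
  by rewrite inE => /eqP; exists x.
have phiD : {morph phi : a b / (a + b)%R}.
  move=> a b; have [->|a0] := eqVneq a 0%R; first by rewrite phi0 !add0r.
  have [->|b0] := eqVneq b 0%R; first by rewrite phi0 !addr0.
  have [->|ab] := eqVneq a b; first by rewrite addrr_rV2 addrr_F2.
  have [x xa] := occ _ a0; have [y yb] := occ _ b0.
  have xy : x != y by apply: contraNneq ab => E; rewrite -xa -yb E.
  have [z [lz fz]] := third_label xy.
  by rewrite -xa -yb -lz !phiP.
exists (fun i => phi (delta_mx ord0 i)) => x.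
rewrite -phiP {1}[lam x]row_sum_delta (big_morph phi phiD phi0).
apply: eq_bigr => i _; case: (F2_cases (lam x ord0 i)) => ->.
  by rewrite scale0r mul0r.
by rewrite scale1r mul1r.
Qed.

Hypothesis f_not_functional :
  ~ exists w : 'I_m -> 'F_2, forall x, f x = (\sum_i lam x ord0 i * w i)%R.

(* Some point has label (0, 1), since otherwise f is a functional of lam. The set
   of occupied labels together with 0 is closed under addition, hence everything,
   and all occupied nonzero labels have fibres of size n_0 + 1. *)
Lemma card_fibre_extend :
  #|fibre extend_label 0%R| = n.-1 /\
  forall a, a != 0%R -> #|fibre extend_label a| = n.
Proof.
have ext0 x a c : (extend_label x == row_mx a c%:M) = (lam x == a) && (f x == c).
  apply/eqP/andP => [/eq_row_mx[-> /matrixP/(_ ord0 ord0)]|[/eqP <- /eqP <-]] //.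
  by rewrite !mxE !mulr1n => ->.
have row0E : 0%R = row_mx 0%R (0%R)%:M :> 'rV['F_2]_(m + 1).
  by apply/rowP=> i; rewrite !mxE; case: split => k; rewrite !mxE ?mul0rn.
have [x lx fx] : exists2 x, lam x = 0%R & f x = 1%R.
  have : ~~ [forall x, (lam x == 0%R) ==> (f x == 0%R)].
    apply/negP=> /forallP f0; apply/f_not_functional/functional_of_label => x lx.
    by move: (f0 x); rewrite lx eqxx => /eqP.
  rewrite negb_forall => /existsP[x]; rewrite negb_imply => /andP[/eqP lx f0].
  by exists x => //; case: (F2_cases (f x)) f0 => -> //; rewrite eqxx.
have char2 := @addrr_rV2 (m + 1).
have occ y : extend_label y != 0%R ->
    #|fibre extend_label (extend_label y)| = #|fibre extend_label 0%R|.+1.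
  exact: (card_fibre_occupied char2 compatible_extend).
have x0 : extend_label x != 0%R by rewrite row0E ext0 fx oner_eq0 andbF.
have xE : extend_label x = row_mx 0%R (1%R)%:M by apply/eqP; rewrite ext0 lx fx !eqxx.
have disj : fibre extend_label 0%R :&: fibre extend_label (extend_label x) = set0.
  apply/setP=> y; rewrite !inE; apply/negP=> /andP[/eqP -> /eqP E].
  by rewrite -E eqxx in x0.
(* The zero fibre of [lam] splits into the fibres over (0, 0) and (0, 1). The second is larger by
   one, so k + (k + 1) = 2n - 1 gives k = n - 1. *)
have card0 : #|fibre extend_label 0%R| = n.-1.
  have : #|fibre lam 0%R| = #|fibre extend_label 0%R| + #|fibre extend_label (extend_label x)|.
    rewrite -cardsUI disj cards0 addn0; apply: eq_card => y.
    rewrite !inE xE row0E !ext0; case: (F2_cases (f y)) => ->.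
      by rewrite eqxx andbT (eq_sym 0%R) oner_eq0 andbF orbF.
    by rewrite eqxx oner_eq0 andbT andbF.
  rewrite occ // fibre0 gE addnS addnn => /(congr1 succn).
  by rewrite prednK ?double_gt0 // -doubleS => /double_inj ->.
split=> // a; rewrite -(hsubmxK a) (mx11_scalar (rsubmx a)).
set u := lsubmx a; set c := rsubmx a _ _ => a0.
suff [y yE] : exists y, extend_label y = row_mx u c%:M.
  by rewrite -yE occ ?yE // card0 prednK.
(* For u = 0 the last coordinate must be 1 and [x] serves. Otherwise take [y] over u; if its last
   coordinate is wrong, the third point of [y] and [x] flips it. *)
have [u0|u0] := eqVneq u 0%R.
  exists x; rewrite xE u0; case: (F2_cases c) => cE; rewrite cE //.
  by rewrite u0 cE -row0E eqxx in a0.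
have /card_gt0P[y] : 0 < #|fibre lam u| by rewrite fibreN0 // gE double_gt0.
rewrite inE => /eqP ly; have [<-|fy] := eqVneq (f y) c.
  by exists y; apply/eqP; rewrite ext0 ly !eqxx.
have yx : y != x by apply: contraNneq u0 => E; rewrite -ly E lx.
have [z [lz fz]] := third_label yx; exists z; apply/eqP.
rewrite ext0 lz fz ly lx addr0 eqxx fx /=.
by case: (F2_cases (f y)) fy => ->; case: (F2_cases c) => ->.
Qed.

End Extension.

(** * The 2-rank and the dual code *)

Section RankDuality.
Variables (V : finType) (m : nat) (lam : V -> 'rV['F_2]_m) (B : {set {set V}}).
Hypothesis lam_surj : forall a, exists x, lam x = a.
Hypothesis lamB : forall b, b \in B -> (\sum_(x in b) lam x = 0)%R.

Definition point_row (f : V -> 'F_2) : 'rV['F_2]_#|V| := \row_k f (enum_val k).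

Definition label_mx : 'M['F_2]_(m, #|V|) := \matrix_(i, k) lam (enum_val k) ord0 i.

Lemma incidence_sum p (A : 'M['F_2]_(p, #|V|)) i b :
  (A *m (incidence_mx B)^T)%R i b = (\sum_(x in (enum_val b : {set V})) A i (enum_rank x))%R.
Proof.
rewrite mxE [RHS]big_mkcond [RHS](reindex (fun k : 'I_#|V| => enum_val k)) /=; last first.
  by exists enum_rank => k _; rewrite ?enum_valK ?enum_rankK.
by apply: eq_bigr => k _; rewrite !mxE enum_valK; case: ifP; rewrite ?mulr1 ?mulr0.
Qed.

Lemma point_row_dual f : (point_row f <= kermx (incidence_mx B)^T)%MS <->
  (forall b, b \in B -> (\sum_(x in b) f x = 0)%R).
Proof.
have rowE b : (point_row f *m (incidence_mx B)^T)%R ord0 b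
    = (\sum_(x in (enum_val b : {set V})) f x)%R.
  by rewrite incidence_sum; apply: eq_bigr => x _; rewrite mxE enum_rankK.
split=> [/sub_kermxP/rowP E b bB|fB].
  have := E (enum_rank_in bB b); rewrite rowE mxE enum_rankK_in //.
by apply/sub_kermxP/rowP=> b; rewrite rowE mxE fB // enum_valP.
Qed.

Lemma label_mx_dual : (label_mx <= kermx (incidence_mx B)^T)%MS.
Proof.
apply/sub_kermxP/matrixP=> i b; rewrite incidence_sum mxE.
under eq_bigr do rewrite mxE enum_rankK.
have /rowP/(_ i) := lamB (enum_valP b); rewrite summxE mxE.
by [].
Qed.

(** Points labelled by unit vectors read off the coefficients of a vanishing combination of rows. *)
Lemma rank_label_mx : \rank label_mx = m.
Proof.
apply/eqP/inj_row_free => v v0; apply/rowP=> i; rewrite mxE.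
have [x lx] := lam_surj (delta_mx ord0 i).
have /rowP/(_ (enum_rank x)) := v0; rewrite !mxE.
under eq_bigr do rewrite mxE enum_rankK lx mxE eqxx /=.
by rewrite (bigD1 i) //= eqxx mulr1 big1 ?addr0 // => j /negPf->; rewrite mulr0.
Qed.

Lemma point_row_label f : (point_row f <= label_mx)%MS <->
  exists w : 'I_m -> 'F_2, forall x, f x = (\sum_i lam x ord0 i * w i)%R.
Proof.
split=> [/submxP[w /rowP E]|[w fw]].
  exists (w ord0) => x; have := E (enum_rank x); rewrite !mxE enum_rankK => ->.
  by apply: eq_bigr => i _; rewrite !mxE enum_rankK mulrC.
apply/submxP; exists (\row_i w i)%R; apply/rowP=> k; rewrite !mxE fw.
by apply: eq_bigr => i _; rewrite !mxE mulrC.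
Qed.

Lemma two_rank_dual : two_rank B = #|V| - m <->
  (forall f : V -> 'F_2, (forall b, b \in B -> (\sum_(x in b) f x = 0)%R) ->
    exists w : 'I_m -> 'F_2, forall x, f x = (\sum_i lam x ord0 i * w i)%R).
Proof.
have rkE : \rank (kermx (incidence_mx B)^T) = #|V| - two_rank B.
  by rewrite mxrank_ker mxrank_tr.
have rV : two_rank B <= #|V| by apply: rank_leq_col.
have mV : m <= #|V| by rewrite -rank_label_mx rank_leq_col.
have iffK : (kermx (incidence_mx B)^T <= label_mx)%MS <-> two_rank B = #|V| - m.
  have := mxrank_leqif_sup label_mx_dual.
  rewrite rank_label_mx rkE => -[_ <-]; split=> [/eqP ->|->].
    by rewrite subKn.
  by rewrite subKn.
split=> [/iffK K f /point_row_dual fB|K].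
  by apply/point_row_label; apply: submx_trans fB K.
apply/iffK/row_subP=> i; set u := row i _.
have uE : u = point_row (fun x => u ord0 (enum_rank x)).
  by apply/rowP=> k; rewrite [RHS]mxE enum_valK.
by rewrite uE; apply/point_row_label/K/point_row_dual; rewrite -uE row_sub.
Qed.

End RankDuality.

Lemma card_rV2 m : #|'rV['F_2]_m| = 2 ^ m.
Proof. by rewrite card_mx card_Fp // mul1n. Qed.

(** * Bounding the compatible systems of other rank *)

Section ExcessDesigns.
Variables (V : finType) (m : nat) (lam : V -> 'rV['F_2]_m).
Variables (n g : nat).
Hypotheses (gE : g = n.*2) (n0 : 1 < n).
Hypothesis fibre0 : #|fibre lam 0%R| = g.-1.
Hypothesis fibreN0 : forall a, a != 0%R -> #|fibre lam a| = g.

Lemma label_surj a : exists x, lam x = a.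
Proof.
suff : 0 < #|fibre lam a| by case/card_gt0P=> x; rewrite inE => /eqP; exists x.
have [->|/fibreN0 ->] := eqVneq a 0%R; rewrite ?fibre0 gE.
  by rewrite -(prednK (ltnW n0)).
by rewrite double_gt0 ltnW.
Qed.

Definition good_extensions : {set {ffun V -> 'F_2}} :=
  [set f : {ffun V -> 'F_2} | (#|fibre (extend_label lam f) 0%R| == n.-1) &&
    [forall a, (a != 0%R) ==> (#|fibre (extend_label lam f) a| == n)]].

(** A binary word is determined by where it is 1 in each fibre of [lam]; for a good one this is an
    [n]-subset, since labels (a, 1) are nonzero. *)
Lemma card_good_extensions :
  #|good_extensions| <= 'C(g.-1, n) * 'C(g, n) ^ (2 ^ m).-1.
Proof.
pose F (f : {ffun V -> 'F_2}) := [ffun a => [set x in fibre lam a | f x == 1%R]].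
have injF : injective F.
  move=> f f' /ffunP E; apply/ffunP=> x; have := E (lam x).
  rewrite !ffunE => /setP/(_ x); rewrite !inE eqxx /=.
  by case: (F2_cases (f x)) => ->; case: (F2_cases (f' x)) => ->.
rewrite -(card_imset _ injF).
apply: (@leq_trans #|family (fun a => [set A : {set V} | A \subset fibre lam a & #|A| == n])|).
  apply/subset_leq_card/subsetP=> _ /imsetP[f fQ ->]; apply/familyP=> a.
  rewrite ffunE inE; apply/andP; split; first by apply/subsetP=> x; rewrite inE => /andP[].
  move: fQ; rewrite inE => /andP[_ /forallP/(_ (row_mx a (1%R)%:M))].
  have -> /= : row_mx a (1%R)%:M != 0%R.
    apply/eqP=> /rowP/(_ (rshift m ord0)); rewrite row_mxEr !mxE.
    by [].
  move=> /eqP <-; apply/eqP/eq_card=> x; rewrite !inE.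
  apply/andP/eqP => [[/eqP <- /eqP <-] //|/eq_row_mx[-> /matrixP/(_ ord0 ord0)]].
  by rewrite !mxE !mulr1n => ->.
rewrite card_family foldrE big_image /= (bigD1 0%R) //=.
rewrite cards_draws fibre0 leq_mul2l; apply/orP; right.
rewrite -card_rV2 -(cardsC1 (0%R : 'rV['F_2]_m)) -prod_nat_const.
rewrite [X in _ <= X](eq_bigl (fun a => a != 0%R)); last by move=> a; rewrite !inE.
by rewrite (eq_bigr (fun=> 'C(g, n))) // => a a0; rewrite cards_draws fibreN0.
Qed.

(** Union bound: a system of another rank has a dual word that is no functional of [lam], and it is
    compatible with the good extension by this word. *)
Lemma card_excess_designs N :
  (forall f, f \in good_extensions ->
     #|[set B | compatible_STS (extend_label lam f) B]| <= N) ->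
  #|[set B | compatible_STS lam B & two_rank B != #|V| - m]|
    <= 'C(g.-1, n) * 'C(g, n) ^ (2 ^ m).-1 * N.
Proof.
move=> le_N; apply: (@leq_trans (#|good_extensions| * N)); last first.
  by rewrite leq_mul2r card_good_extensions orbT.
rewrite -sum_nat_const.
apply: (@leq_trans #|\bigcup_(f in good_extensions) [set B | compatible_STS (extend_label lam f) B]|).
  apply/subset_leq_card/subsetP=> B; rewrite inE => /andP[cB rB].
  have lamB b : b \in B -> (\sum_(x in b) lam x = 0)%R.
    by move=> bB; have /andP[_ /eqP] := compatible_block cB bB.
  pose Bad (f : {ffun V -> 'F_2}) := [forall b in B, (\sum_(x in b) f x == 0)%R] &&
    ~~ [exists w : {ffun 'I_m -> 'F_2}, [forall x, f x == (\sum_i lam x ord0 i * w i)%R]].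
  have [f /andP[/forall_inP fB fw]] : exists f, Bad f.
    apply/existsP; apply: contraNT rB; rewrite negb_exists => /forallP noBad; apply/eqP.
    apply/(two_rank_dual label_surj lamB) => f fB.
    have := noBad (finfun f); rewrite /Bad negb_and negbK => /orP[/negP[]|].
      apply/forall_inP=> b bB; under eq_bigr do rewrite ffunE.
      by rewrite fB.
    by case/existsP=> w /forallP fw; exists w => x; rewrite -(eqP (fw x)) ffunE.
  have fB' b : b \in B -> (\sum_(x in b) f x = 0)%R by move=> bB; apply/eqP/fB.
  apply/bigcupP; exists f; last by rewrite inE compatible_extend.
  have fw' : ~ exists w : 'I_m -> 'F_2, forall x, f x = (\sum_i lam x ord0 i * w i)%R.
    case=> w wE; case/existsP: fw; exists (finfun w); apply/forallP=> x; rewrite wE.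
    by apply/eqP/eq_bigr => i _; rewrite ffunE.
  have [c0 c1] := card_fibre_extend cB gE (ltnW n0) fibre0 fibreN0 fB' fw'.
  by rewrite inE c0 eqxx; apply/forallP=> a; apply/implyP=> /c1 ->.
apply: (@leq_trans (\sum_(f in good_extensions) #|[set B | compatible_STS (extend_label lam f) B]|)).
  elim/big_rec2: _ => [|f s A _ IH]; first by rewrite cards0.
  by rewrite (leq_trans (leq_card_setU _ _)) // leq_add2l.
by apply: leq_sum => f /le_N.
Qed.

End ExcessDesigns.

(** * Counting isomorphism classes from below *)

Section IsomorphismClasses.
Variable V : finType.

Definition perm_blocks (s : {perm V}) (B : {set {set V}}) : {set {set V}} :=
  [set [set s x | x in b] | b : {set V} in B].

Lemma STS_isoP B B' : reflect (exists s, B' = perm_blocks s B) (STS_iso B B').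
Proof. by apply: (iffP existsP) => [[s /eqP E]|[s E]]; exists s => //; apply/eqP. Qed.

Lemma perm_blocksM s s' B : perm_blocks (s * s')%g B = perm_blocks s' (perm_blocks s B).
Proof.
rewrite /perm_blocks -imset_comp; apply: eq_imset => b /=; rewrite -imset_comp.
by apply: eq_imset => x; rewrite permM.
Qed.

Lemma perm_blocks1 B : perm_blocks 1%g B = B.
Proof.
rewrite /perm_blocks -[RHS]imset_id; apply: eq_imset => b /=.
by rewrite -[RHS]imset_id; apply: eq_imset => x; rewrite perm1.
Qed.

(** The classes of [Y] cover [X], and a class meeting [X] is compared with the bound at one of its
    members in [X]. *)
Lemma card_le_classes (X Y : {set {set {set V}}}) K : X \subset Y ->
  (forall B, B \in X -> #|[set B' in X | STS_iso B B']| <= K) ->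
  #|X| <= #|equivalence_partition (@STS_iso V) Y| * K.
Proof.
move=> /subsetP XY XK; set P := equivalence_partition _ _.
have iso_refl (B : {set {set V}}) : STS_iso B B by apply/STS_isoP; exists 1%g; rewrite perm_blocks1.
apply: (@leq_trans (\sum_(c in P) #|c :&: X|)).
  apply: (@leq_trans #|\bigcup_(c in P) (c :&: X)|).
    apply/subset_leq_card/subsetP=> B BX; apply/bigcupP.
    exists [set B' in Y | STS_iso B B']; first by rewrite imset_f // XY.
    by rewrite !inE iso_refl BX XY.
  elim/big_rec2: _ => [|f s A _ IH]; first by rewrite cards0.
  by rewrite (leq_trans (leq_card_setU _ _)) // leq_add2l.
rewrite -sum_nat_const; apply: leq_sum => _ /imsetP[B BY ->].
have [->|[B0]] := set_0Vmem ([set B' in Y | STS_iso B B'] :&: X).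
  by rewrite cards0.
rewrite !inE => /andP[/andP[_ /STS_isoP[s B0E]] B0X].
apply: leq_trans (XK _ B0X); apply/subset_leq_card/subsetP=> B1.
rewrite !inE => /andP[/andP[_ /STS_isoP[s' B1E]] ->] /=.
apply/STS_isoP; exists (s^-1 * s')%g.
by rewrite B0E B1E perm_blocksM -(perm_blocksM s) mulgV perm_blocks1.
Qed.

End IsomorphismClasses.

(** * Permutations acting linearly on labels *)

Section LabelAutomorphisms.
Variables (V : finType) (m : nat) (lam : V -> 'rV['F_2]_m.+1).
Variables (g : nat).
Hypothesis fibre0 : #|fibre lam 0%R| = g.-1.
Hypothesis fibreN0 : forall a, a != 0%R -> #|fibre lam a| = g.

Definition linear_perms (A : 'M['F_2]_m.+1) : {set {perm V}} :=
  [set s : {perm V} | [forall x, lam (s x) == (lam x *m A)%R]].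

Lemma linear_permsP A (s : {perm V}) :
  reflect (forall x, lam (s x) = (lam x *m A)%R) (s \in linear_perms A).
Proof. by rewrite inE; apply: (iffP forallP) => E x; apply/eqP/E. Qed.

(** Such a permutation preserves every fibre and is determined by its restrictions to the fibres. *)
Lemma card_linear_perms1 :
  #|linear_perms 1%:M| <= g.-1`! * g`! ^ (2 ^ m.+1).-1.
Proof.
pose F (s : {perm V}) := [ffun a => restr_perm (fibre lam a) s].
have fixF s a : s \in linear_perms 1%:M -> s \in 'N(fibre lam a | 'P)%g.
  move=> /linear_permsP sE; rewrite !inE /=; apply/subsetP=> x.
  by rewrite !inE /= apermE sE mulmx1.
have injF : {in linear_perms 1%:M &, injective F}.
  move=> s s' sA sA' /ffunP E; apply/permP=> x; have := E (lam x); rewrite !ffunE.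
  have xx : x \in fibre lam (lam x) by rewrite inE.
  by move/permP/(_ x); rewrite !restr_permE ?fixF.
rewrite -(card_in_imset injF).
apply: (@leq_trans #|family (fun a => [set s | perm_on (fibre lam a) s])|).
  apply/subset_leq_card/subsetP=> _ /imsetP[s _ ->]; apply/familyP=> a.
  by rewrite ffunE inE restr_perm_on.
rewrite card_family foldrE big_image /= (bigD1 0%R) //=.
rewrite cardsE card_perm fibre0 leq_mul2l; apply/orP; right.
rewrite -card_rV2 -(cardsC1 (0%R : 'rV['F_2]_m.+1)) -prod_nat_const.
rewrite [X in _ <= X](eq_bigl (fun a => a != 0%R)); last by move=> a; rewrite !inE.
by rewrite (eq_bigr (fun=> g`!)) // => a a0; rewrite cardsE card_perm fibreN0.
Qed.

(** Right multiplication by the inverse of one fixed member embeds the set into the fibre-preserving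
    permutations. *)
Lemma card_linear_perms A : A \in unitmx ->
  #|linear_perms A| <= #|linear_perms 1%:M|.
Proof.
move=> uA; have [->|[s0 /linear_permsP s0A]] := set_0Vmem (linear_perms A).
  by rewrite cards0.
rewrite -(card_imset _ (mulIg s0^-1%g)).
apply/subset_leq_card/subsetP=> _ /imsetP[s /linear_permsP sA ->].
apply/linear_permsP=> x; rewrite permM mulmx1.
apply: (can_inj (mulmxK uA)).
by rewrite -s0A permKV sA.
Qed.

(** Each coordinate of [lam \o s] is a dual word of [B], hence a functional of [lam]; the
    coefficients form the columns of [A]. *)
Lemma iso_linear (B B' : {set {set V}}) (s : {perm V}) : (forall a, exists x, lam x = a) ->
  (forall b, b \in B -> (\sum_(x in b) lam x = 0)%R) ->
  two_rank B = #|V| - m.+1 ->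
  (forall b, b \in B' -> (\sum_(x in b) lam x = 0)%R) ->
  B' = perm_blocks s B -> exists2 A, A \in unitmx & s \in linear_perms A.
Proof.
move=> lam_surj lamB rB lamB' B'E.
have /fin_all_exists[w wE] : forall i : 'I_m.+1, exists wi : 'I_m.+1 -> 'F_2,
    forall x, lam (s x) ord0 i = (\sum_k lam x ord0 k * wi k)%R.
  move=> i.
  apply: (proj1 (two_rank_dual lam_surj lamB) rB (fun x => lam (s x) ord0 i)) => b bB.
  have /rowP/(_ i) : (\sum_(y in [set s x | x in b]) lam y = 0)%R.
    by apply: lamB'; rewrite B'E imset_f.
  rewrite summxE mxE big_imset //= => x y _ _; exact: perm_inj.
pose A : 'M['F_2]_m.+1 := (\matrix_(k, i) w i k)%R.
have sA x : lam (s x) = (lam x *m A)%R.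
  by apply/rowP=> i; rewrite wE mxE; apply: eq_bigr => k _; rewrite mxE.
exists A; last exact/linear_permsP.
have /fin_all_exists[x xE] : forall i : 'I_m.+1, exists y, lam y = delta_mx ord0 i.
  by move=> i; apply: lam_surj.
(* Pulling points labelled by unit vectors back along [s] gives the rows of a left inverse of
   [A]. *)
have /mulmx1_unit[] // : ((\matrix_i lam (s^-1%g (x i))) *m A = 1%:M)%R.
by apply/row_matrixP=> i; rewrite row_mul rowK -sA permKV xE rowE mulmx1.
Qed.

Lemma card_iso_labelled (X : {set {set {set V}}}) B : (forall a, exists x, lam x = a) ->
  (forall B', B' \in X -> two_rank B' = #|V| - m.+1 /\
     forall b, b \in B' -> (\sum_(x in b) lam x = 0)%R) -> B \in X ->
  #|[set B' in X | STS_iso B B']| <= #|'GL_(m.+1)(2)%g| * (g.-1`! * g`! ^ (2 ^ m.+1).-1).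
Proof.
move=> lam_surj XP BX; have [rB lamB] := XP _ BX.
apply: (@leq_trans #|[set perm_blocks s B | s in \bigcup_(u : {'GL_m.+1['F_2]}) linear_perms (GLval u)]|).
  apply/subset_leq_card/subsetP=> B'; rewrite inE => /andP[B'X /STS_isoP[s B'E]].
  have [_ lamB'] := XP _ B'X.
  have [A uA sA] := iso_linear lam_surj lamB rB lamB' B'E.
  apply/imsetP; exists s => //; apply/bigcupP.
  by exists (Sub A uA).
apply: leq_trans (leq_imset_card _ _) _.
apply: (@leq_trans (\sum_(u : {'GL_m.+1['F_2]}) #|linear_perms (GLval u)|)).
  elim/big_rec2: _ => [|f r A _ IH]; first by rewrite cards0.
  by rewrite (leq_trans (leq_card_setU _ _)) // leq_add2l.
rewrite cardsT -sum_nat_const; apply: leq_sum => u _.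
by apply: leq_trans (card_linear_perms _) card_linear_perms1; apply: (valP u).
Qed.

End LabelAutomorphisms.

(** * Assembling the inequality *)

Lemma exists_labelling (V L : finType) (k : L -> nat) : \sum_a k a = #|V| ->
  exists lam : V -> L, forall a, #|[set x | lam x == a]| = k a.
Proof.
move=> kV; have kS : #|{: {a : L & 'I_(k a)}}| = #|V|.
  rewrite card_tagged sumnE big_map -kV big_enum /=.
  by apply: eq_bigr => a _; rewrite card_ord.
pose q p : V := enum_val (cast_ord kS (enum_rank p)).
pose r x : {a : L & 'I_(k a)} := enum_val (cast_ord (esym kS) (enum_rank x)).
have qK : cancel q r by move=> p; rewrite /r /q enum_valK cast_ordK enum_rankK.
have rK : cancel r q by move=> x; rewrite /r /q enum_valK cast_ordKV enum_rankK.
exists (fun x => tag (r x)) => a.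
have injq : injective (fun i : 'I_(k a) => q (Tagged _ i)).
  by move=> i j /(can_inj qK) /eqP; rewrite eq_Tagged => /eqP.
rewrite -[RHS]card_ord -(card_imset _ injq); apply: eq_card => x; rewrite inE.
apply/eqP/imsetP => [<-|[i _ ->]]; last by rewrite qK.
by exists (tagged (r x)); rewrite // taggedK rK.
Qed.

(** The systems compatible with one fixed labelling are split by rank: those of the wanted rank are
    bounded by classes times isomorphisms, the others by extensions times the count for halved
    fibres. *)
Lemma card_compatible_bound m t g h M M' : 1 < t ->
  g = 2 ^ t -> h = 2 ^ t.-1 -> M = (2 ^ m.+1).-1 -> M' = (2 ^ m.+2).-1 ->
  num_STS g.-1 * (num_one_factorizations g * g.-1`!) ^ M * num_TD3 g ^ (M * M.-1 %/ 6)
  <= num_STS_classes (2 ^ (m.+1 + t) - 1) (2 ^ (m.+1 + t) - 1 - m.+1)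
       * (#|'GL_(m.+1)(2)%g| * (g.-1`! * g`! ^ M))
     + 'C(g.-1, h) * 'C(g, h) ^ M
       * (num_STS h.-1 * (num_one_factorizations h * h.-1`!) ^ M'
          * num_TD3 h ^ (M' * M'.-1 %/ 6)).
Proof.
move=> t1 gt ht ME M'E; set v := _ - 1.
have gE : g = h.*2 by rewrite gt ht -[in LHS](prednK (ltnW t1)) expnS mul2n.
(* As t is at least 2, [h] is even, so the counting formula also applies to the halved fibres. *)
have hE : h = (2 ^ t.-2).*2 by rewrite ht -mul2n -expnS; congr (2 ^ _); lia.
have n0 : 0 < 2 ^ t.-2 by rewrite expn_gt0.
have h1 : 1 < h by rewrite hE; lia.
have [lam lamE] : exists lam : 'I_v -> 'rV['F_2]_m.+1,
    forall a, #|[set x | lam x == a]| = if a == 0%R then g.-1 else g.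
  apply: exists_labelling; rewrite (bigD1 0%R) //= eqxx.
  rewrite (eq_bigr (fun=> g)) => [|a /negPf-> //]; rewrite sum_nat_const card_ord.
  rewrite -[#|_|]/#|(predC1 (0%R : 'rV['F_2]_m.+1))| cardC1 card_rV2 /v expnD -gt.
  have g0 : 0 < g by rewrite gt expn_gt0.
  have p0 : 0 < 2 ^ m.+1 by rewrite expn_gt0.
  nia.
have f0 : #|fibre lam 0%R| = g.-1 by rewrite lamE eqxx.
have f1 a : a != 0%R -> #|fibre lam a| = g by move=> /negPf a0; rewrite lamE a0.
have F2 k := @addrr_rV2 k.
have := card_compatible_STS_formula (F2 _) gE (ltnW h1) f0 f1.
rewrite card_rV2 -ME => <-.
have le_excess := card_excess_designs gE h1 f0 f1; rewrite -ME in le_excess.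
set N' := num_STS h.-1 * _ * _.
have {}le_excess : #|[set B | compatible_STS lam B & two_rank B != #|'I_v| - m.+1]|
    <= 'C(g.-1, h) * 'C(g, h) ^ M * N'.
  apply: le_excess => f; rewrite inE => /andP[/eqP c0 /forallP c1].
  have c1' a : a != 0%R -> #|fibre (extend_label lam f) a| = h.
    by move=> a0; apply/eqP; move: (c1 a); rewrite a0.
  have M'V : #|'rV['F_2]_(m.+1 + 1)|.-1 = M' by rewrite card_rV2 addn1.
  have := card_compatible_STS_formula (F2 _) hE n0 c0 c1'.
  by rewrite M'V => ->.
set X := [set B | compatible_STS lam B & two_rank B == #|'I_v| - m.+1].
have le_X : #|X| <= num_STS_classes v (v - m.+1) * (#|'GL_(m.+1)(2)%g| * (g.-1`! * g`! ^ M)).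
  apply: card_le_classes.
    by apply/subsetP=> B; rewrite !inE card_ord => /andP[/andP[-> _] ->].
  move=> B BX; rewrite ME; apply: (card_iso_labelled f0 f1 (label_surj gE h1 f0 f1) _ BX).
  move=> B'; rewrite inE => /andP[cB /eqP ->]; split=> // b bB.
  by have /andP[_ /eqP] := compatible_block cB bB.
apply: leq_trans (leq_add le_X le_excess).
apply: leq_trans (leq_card_setU _ _); apply/subset_leq_card/subsetP=> B.
by rewrite !inE => ->; case: eqP.
Qed.

Lemma bin_factorial_bound h M : 0 < h ->
  'C(h.*2.-1, h) * 'C(h.*2, h) ^ M * h`! ^ (M.*2.+1) <= h.*2.-1`! * h.*2`! ^ M.
Proof.
move=> h0; have h2 : h <= h.*2.-1 by lia.
have le1 : 'C(h.*2.-1, h) * h`! <= h.*2.-1`!.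
  by rewrite -(bin_fact h2) mulnA leq_pmulr // fact_gt0.
have e2 : 'C(h.*2, h) * (h`! * h`!) = h.*2`!.
  by have := @bin_fact h.*2 h; rewrite (_ : h.*2 - h = h); [apply | ]; lia.
rewrite expnS -(mul2n M) expnM -mulnn mulnACA -expnMn e2.
by rewrite leq_mul2r le1 orbT.
Qed.

(** After division by [K] the error term is at most [N / H ^ d], and lowering the exponent to [e]
    only enlarges it because [H] is at least 1. *)
Lemma rat_bound_of_nat (A K Q N c H d : nat) (e : int) : 0 < K -> 0 < H ->
  A <= c * K + Q * N -> Q * H ^ d <= K -> (e <= d%:Z)%R ->
  (A%:R / K%:R - N%:R / H%:R ^ e <= c%:R :> rat)%R.
Proof.
move=> K0 H0 le_A le_Q ed.
have K0' : (0 < K%:R :> rat)%R by rewrite ltr0n.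
have H1' : (1 <= H%:R :> rat)%R by rewrite ler1n.
have He (z : int) : (0 < H%:R ^ z :> rat)%R by rewrite exprz_gt0 // ltr0n.
rewrite lerBlDr ler_pdivrMr // mulrDl.
apply: (@le_trans _ _ (c * K + Q * N)%N%:R%R); first by rewrite ler_nat.
rewrite natrD !natrM lerD2l mulrC -mulrA ler_wpM2l //.
rewrite -ler_pdivrMl ?invr_gt0 // invrK mulrC.
apply: (@le_trans _ _ (Q%:R * H%:R ^ d%:Z)%R).
  by rewrite ler_wpM2l // ler_weXz2l.
by rewrite -exprnP -natrX -natrM ler_nat.
Qed.

Local Open Scope ring_scope.

Theorem theorem4p12 (n t : nat) (ht2 : (2 <= t)%N) (htn : (t <= n - 1)%N) :
  let T := (2 ^ t - 1)%N in
  let T' := (2 ^ (t - 1) - 1)%N in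
  let M := (2 ^ (n - t) - 1)%N in
  let M' := (2 ^ (n - t + 1) - 1)%N in
  (num_STS T * (num_one_factorizations T.+1 * T`!) ^ M
     * num_TD3 T.+1 ^ (M * (M - 1) %/ 6))%N%:R
    / (T`! * T.+1`! ^ M * #|'GL_(n - t)(2)%g|)%N%:R
  - (num_STS T' * (num_one_factorizations T'.+1 * T'`!) ^ M'
       * num_TD3 T'.+1 ^ (M' * (M' - 1) %/ 6))%N%:R
    / (T'.+1`!)%:R ^ (M'%:Z - n%:Z + t%:Z - 2)
  <= (num_STS_classes (2 ^ n - 1) (2 ^ n - n - 1 + t))%:R :> rat.
Proof.
cbv zeta.
have [m mE] : exists m, (n - t = m.+1)%N by exists (n - t).-1; lia.
have nE : (m.+1 + t = n)%N by lia.
have rankE : (2 ^ n - n - 1 + t = 2 ^ n - 1 - m.+1)%N.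
  by have := ltn_expl n (isT : 1 < 2)%N; lia.
have expS k : (2 ^ k - 1).+1 = (2 ^ k)%N by rewrite subn1 prednK ?expn_gt0.
have halfE : (2 ^ t = (2 ^ (t - 1)).*2)%N.
  by rewrite -mul2n -expnS; congr (2 ^ _)%N; lia.
have M'E : (2 ^ m.+2).-1 = (2 ^ m.+1).-1.*2.+1.
  have : (0 < 2 ^ m.+1)%N by rewrite expn_gt0.
  by rewrite (expnS 2 m.+1); move: (2 ^ m.+1)%N => k {halfE rankE}; lia.
rewrite mE addn1 rankE !expS !subn1.
have := @card_compatible_bound m t _ _ _ _ ht2 erefl erefl erefl erefl.
rewrite nE subn1 => le_A.
have h0 : (0 < 2 ^ t.-1)%N by rewrite expn_gt0.
rewrite subn1 in halfE.
have le_Q := bin_factorial_bound (2 ^ m.+1).-1 h0.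
rewrite -halfE -M'E in le_Q.
apply: (rat_bound_of_nat (d := (2 ^ m.+2).-1) _ _ (leq_trans le_A _)).
- by rewrite !muln_gt0 expn_gt0 !fact_gt0 cardG_gt0.
- exact: fact_gt0.
- by rewrite [X in (_ * X + _)%N]mulnC.
- by apply: leq_trans le_Q _; rewrite leq_pmulr // cardG_gt0.
(* The exponent M' - n + t - 2 is at most M' because t is at most n. *)
- by move: (2 ^ m.+2).-1 nE => d; clear; lia.
Qed.
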